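(* For every positive integer $n$ there is a graph $U_n$ of treewidth at most $3$ with at most $n^{20\log_2 n}$ vertices that contains every $n$-vertex graph of treewidth at most $2$ as a subgraph.
   Context: ''$U$ contains $H$ as a subgraph'' means $U$ has a subgraph isomorphic to $H$. Treewidth is the usual notion. *)

(* Defs.v *)
From HB Require Import structures.
From mathcomp Require Import all_boot boolp.

Set Implicit Arguments.
Unset Strict Implicit.
Unset Printing Implicit Defensive.

(** Finite simple graphs; the empty graph is allowed. *)
Record sgraph := SGraph {
  vertex :> finType;
  adj : rel vertex;
  adj_sym : symmetric adj;
  adj_irrefl : irreflexive adj
}.

Definition isomorphic (G H : sgraph) : Prop :=
  exists2 f : G -> H, bijective f & forall x y, adj (f x) (f y) = adj x y.

Record subgraph (G : sgraph) := Subgraph {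
  sub_verts : {set G};
  sub_adj : rel G;
  sub_adj_sym : symmetric sub_adj;
  sub_adjP : forall x y, sub_adj x y ->
    [&& x \in sub_verts, y \in sub_verts & adj x y]
}.

Section SubgraphAsGraph.
Variables (G : sgraph) (S : subgraph G).

Definition subgraph_adj : rel {x : G | x \in sub_verts S} :=
  fun x y => sub_adj S (val x) (val y).

Lemma subgraph_adj_sym : symmetric subgraph_adj.
Proof. by move=> x y; apply: sub_adj_sym. Qed.

Lemma subgraph_adj_irrefl : irreflexive subgraph_adj.
Proof.
by move=> x; apply/negP => /sub_adjP /and3P[_ _]; rewrite adj_irrefl.
Qed.

Definition sgraph_of_subgraph : sgraph :=
  SGraph subgraph_adj_sym subgraph_adj_irrefl.
End SubgraphAsGraph.

Coercion sgraph_of_subgraph : subgraph >-> sgraph.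

Definition contains_subgraph (U H : sgraph) : Prop :=
  exists S : subgraph U, isomorphic S H.

(** [A] induces a connected subgraph of [G], or is empty. *)
Definition connected_in (G : sgraph) (A : {set G}) : Prop :=
  {in A &, forall x y,
     connect [rel a b | [&& a \in A, b \in A & adj a b]] x y}.

(** [ucycle] alone accepts the degenerate closed walk [:: x; y] along an edge,
    hence the bound on the size. *)
Definition acyclic (G : sgraph) : Prop :=
  forall c : seq G, 2 < size c -> ~ ucycle (@adj G) c.

Definition is_tree (T : sgraph) : Prop :=
  [/\ 0 < #|T|, connected_in [set: T] & acyclic T].

Record tree_decomposition (G : sgraph) := TreeDecomposition {
  td_tree : sgraph;
  td_treeP : is_tree td_tree;
  td_bag : td_tree -> {set G};
  td_vertex : forall v : G, exists t, v \in td_bag t;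
  td_edge : forall u v : G, adj u v ->
    exists t, (u \in td_bag t) && (v \in td_bag t);
  td_connected : forall v : G, connected_in [set t | v \in td_bag t]
}.

(** Truncated subtraction: decompositions with only empty bags, which exist
    only for the empty graph, get width 0 instead of -1. *)
Definition td_width (G : sgraph) (D : tree_decomposition G) : nat :=
  (\max_(t : td_tree D) #|td_bag t|).-1.

Section Treewidth.
Variable G : sgraph.

Let point : sgraph :=
  @SGraph unit (fun _ _ => false) (fun _ _ => erefl) (fun _ => erefl).

Let point_connected (A : {set point}) : connected_in A.
Proof. by move=> [] [] _ _; apply: connect0. Qed.

Let point_tree : is_tree point.
Proof.
split; [by rewrite card_unit | exact: point_connected |].
by move=> [|x [|y c]] //= _ /andP[].
Qed.

Definition trivial_td : tree_decomposition G.
Proof.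
exists point (fun _ => [set: G]).
- exact: point_tree.
- by move=> v; exists tt; rewrite inE.
- by move=> u v _; exists tt; rewrite !inE.
- by move=> v; apply: point_connected.
Defined.

Definition is_td_width : pred nat :=
  fun w => `[< exists D : tree_decomposition G, td_width D = w >].

Lemma ex_td_width : exists w, is_td_width w.
Proof. by exists (td_width trivial_td); apply/asboolP; exists trivial_td. Qed.

Definition treewidth : nat := ex_minn ex_td_width.
End Treewidth.

(* Main.v *)
(** A graph of treewidth at most 2 on at least two vertices is a spanning
    subgraph of a 2-tree, which unfolds from a root edge into a ternary tree:
    a vertex [c] stacked on [ab] leaves three independent 2-trees, on [ac], on
    [cb] and (for the vertices stacked later) on [ab].  Follow a heavy path in
    this ternary tree, so that everything hanging off it has at most half the
    size.  The triangles of the path form a strip of fans with centres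
    [c_0, c_1, c_2, ...], the fan at [c_(i+1)] being a path from [c_i] to
    [c_(i+2)].  Strips with arbitrary fan lengths all embed in one graph of
    treewidth 3: take the square of the path of centres and, for each [i], a
    long path starting at [c_i] all of whose vertices see both [c_(i+1)] and
    [c_(i+2)], so that the fan may jump to its last vertex [c_(i+2)] whenever
    needed.  Attaching enough copies of the universal graph for half the size
    to all the edges multiplies the number of vertices by a polynomial at each
    of the logarithmically many levels of the recursion. *)
Require Import Defs.
From mathcomp Require Import all_boot all_order all_algebra zify boolp.
From mathcomp Require Import reals exp.

Set Implicit Arguments.
Unset Strict Implicit.
Unset Printing Implicit Defensive.

Import Order.TTheory GRing.Theory Num.Theory.

(** * Ternary trees and a universal recipe *)

(* Encodes a 2-tree with a given root edge [ab]: in [Node c l r s] the vertex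
   [c] is stacked on [ab], and [l], [r], [s] are rooted at [ac], [cb], [ab]. *)
Inductive ltree (A : Type) := Leaf | Node (c : A) (l r s : ltree A).
Arguments Leaf {A}.

Definition block (m m' : nat) (u : seq nat) : bool :=
  uniq u && all (fun v => m <= v < m') u.

Lemma block_widen m0 m m' m0' u : m0 <= m -> m' <= m0' -> block m m' u -> block m0 m0' u.
Proof.
move=> le_m le_m' /andP[uu /allP u_ran]; rewrite /block uu /=.
by apply/allP => v /u_ran /andP[mv vm']; rewrite (leq_trans le_m) // (leq_trans vm').
Qed.

Lemma block_cat m m1 m2 m' u v :
  m1 <= m2 -> m <= m2 -> m1 <= m' -> block m m1 u -> block m2 m' v ->
  block m m' (u ++ v).
Proof.
move=> le12 le_m le_m' bu bv.
have /andP[_ iu] := block_widen (leqnn m) le_m' bu.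
have /andP[_ iv] := block_widen le_m (leqnn m') bv.
case/andP: bu => uu /allP u1; case/andP: bv => uv /allP v2.
rewrite /block all_cat iu iv cat_uniq uu uv !andbT /=.
apply/hasPn => z /v2 /andP[z2 _]; apply/negP => /u1 /andP[_ z1].
by have := leq_trans (leq_trans z1 le12) z2; rewrite ltnn.
Qed.

Lemma block_cons m m' u : m < m' -> block m.+1 m' u -> block m m' (m :: u).
Proof.
move=> lt_m; rewrite -cat1s; apply: (@block_cat m m.+1 m.+1) => //.
by rewrite /block /= leqnn ltnSn.
Qed.

(** The layout of one step of a fan: a light tree, a gap for skipped light copies, the new fan
    vertex [m2], another light tree, and the rest of the fan. *)
Lemma block_insert m m1 m2 m3 m4 m' us ur u :
  m1 <= m2 -> m2 < m3 -> m3 <= m4 -> m4 <= m' -> m <= m2 ->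
  block m m1 us -> block m2.+1 m3 ur -> block m3 m4 u ->
  block m m' (us ++ m2 :: ur ++ u).
Proof.
move=> le12 lt23 le34 le4 le_m bus bur bu.
have le24 : m2 < m4 by apply: leq_trans le34.
have bm : block m2 m4 (m2 :: ur ++ u).
  by apply: block_cons le24 _; apply: block_cat (leqnn _) _ _ bur bu => //; apply: ltnW.
have le14 : m1 <= m' := leq_trans le12 (leq_trans (ltnW le24) le4).
exact: block_cat le12 le_m le14 bus (block_widen (leqnn _) le4 bm).
Qed.

Section LabelledTrees.
Variable A : Type.
Implicit Types t l r s : ltree A.

Fixpoint labels t : seq A :=
  if t is Node c l r s then c :: labels l ++ labels r ++ labels s else [::].

Fixpoint edges (a b : A) t : seq (A * A) :=
  if t is Node c l r s then edges a c l ++ edges c b r ++ edges a b s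
  else [:: (a, b)].

Fixpoint weight t : nat :=
  if t is Node _ l r s then (weight l + weight r + weight s).+1 else 0.

Fixpoint flip t : ltree A :=
  if t is Node c l r s then Node c (flip r) (flip l) (flip s) else Leaf.

(* Tells whether the heavy path next moves from [ab] to an edge at [a]; a step
   with the heavy part on [ab] itself does not count as a move. *)
Fixpoint keeps_left (h : nat) t : bool :=
  if t is Node _ l r s then
    if weight l + weight r < h then keeps_left h s else weight r <= weight l
  else true.

Lemma size_labels t : size (labels t) = weight t.
Proof. by elim: t => //= c l Hl r Hr s Hs; rewrite !size_cat; lia. Qed.

Lemma weight_flip t : weight (flip t) = weight t.
Proof. by elim: t => //= c l -> r -> s ->; lia. Qed.

Lemma keeps_left_flip h t : ~~ keeps_left h t -> keeps_left h (flip t).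
Proof.
elim: t => //= c l _ r _ s IHs; rewrite !weight_flip addnC.
by case: ifP => // _; lia.
Qed.

Section Placement.
Variable e : rel nat.

(** An embedding of the shape of [t] with root edge [xy]; the labels are ignored. The images [u]
    matter only up to permutation, because recipes create vertices in another order than
    [labels]. *)
Fixpoint place (x y : nat) t (u : seq nat) : Prop :=
  if t is Node _ l r s then
    exists c ul ur us,
      [/\ perm_eq u (c :: ul ++ ur ++ us), e c x, e c y &
          [/\ place x c l ul, place c y r ur & place x y s us]]
  else u = [::].

Lemma place_flip x y t u : place x y (flip t) u -> place y x t u.
Proof.
elim: t x y u => //= _ l IHl r IHr s IHs x y u [c [ul [ur [us]]]].
case=> pu ex ey [/IHr pr /IHl pl /IHs ps]; exists c, ur, ul, us; split=> //.
by apply/permP => P; move/permP/(_ P): pu => /= ->; rewrite !count_cat; lia.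
Qed.

Lemma perm_place x y t u v : perm_eq u v -> place x y t u -> place x y t v.
Proof.
case: t => [|_ l r s] /= uv; first by move=> u0; apply/perm_nilP; rewrite perm_sym -u0.
case=> c [ul [ur [us [pu ? ? ?]]]]; exists c, ul, ur, us; split=> //.
by rewrite perm_sym in uv; apply: perm_trans uv pu.
Qed.

Lemma place_Node x y c0 l r s u v :
  place x y (Node c0 l r Leaf) u -> place x y s v ->
  place x y (Node c0 l r s) (u ++ v).
Proof.
case=> c [ul [ur [us [pu ex ey [pl pr us0]]]]] ps; move: us0 pu => /= -> pu.
exists c, ul, ur, v; split=> //.
apply/permP => P; move/permP/(_ P): pu => /=.
by rewrite !count_cat /= => ->; lia.
Qed.

Definition fits (m k x y : nat) t : Prop :=
  exists2 u, place x y t u & block m (m + k) u.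

End Placement.
End LabelledTrees.

(* Instructions for growing a graph from a bag of vertices: [New] replaces the
   first vertex of the bag by a new vertex adjacent to all the others. *)
Inductive recipe :=
  | Stop
  | Par (w1 w2 : recipe)
  | Select (i j k l : nat) (w : recipe)
  | New (w : recipe).

Fixpoint wsize (w : recipe) : nat :=
  match w with
  | Stop => 0
  | Par w1 w2 => wsize w1 + wsize w2
  | Select _ _ _ _ w => wsize w
  | New w => (wsize w).+1
  end.

(* The default [head 0 b] keeps out-of-range selections inside the bag. *)
Definition select_bag (i j k l : nat) (b : seq nat) :=
  [seq nth (head 0 b) b a | a <- [:: i; j; k; l]].

(** The relation [e] stays fixed and may have further edges, so all pieces of a recipe speak of one
    ambient graph, their new vertices being numbered from [m] on. *)
Fixpoint built (e : rel nat) (w : recipe) (b : seq nat) (m : nat) : Prop :=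
  match w with
  | Stop => True
  | Par w1 w2 => built e w1 b m /\ built e w2 b (m + wsize w1)
  | Select i j k l w => built e w (select_bag i j k l b) m
  | New w => {in behead b, forall x, e m x} /\ built e w (m :: behead b) m.+1
  end.

(** The two root vertices are not counted in [h]. The rest [b] of the bag is arbitrary, so the
    recipe can be hung on an edge of any bag. *)
Definition universal (h : nat) (w : recipe) : Prop :=
  forall (A : Type) (t : ltree A) (e : rel nat) x y b m, symmetric e ->
    built e w (x :: y :: b) m -> weight t <= h -> fits e m (wsize w) x y t.

Lemma built_iter e k w0 w b m :
  built e (iter k (Par w0) w) b m -> built e w b (m + k * wsize w0).
Proof.
elim: k m => [|k IHk] m /=; first by rewrite mul0n addn0.
by case=> _ /IHk; rewrite mulSn addnA.
Qed.

Lemma wsize_iter k w0 w : wsize (iter k (Par w0) w) = k * wsize w0 + wsize w.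
Proof. by elim: k => //= k ->; rewrite mulSn addnA. Qed.

(** * Heavy paths with light trees attached *)

Section Spine.
Variables (h n : nat) (L : recipe).

(* In bags starting with [p; y; z], [y] is the current centre, [z] the next one
   and [p] the current vertex of the fan of [y]. *)
Definition lights : recipe := Par (Select 1 0 0 0 L) (Select 2 0 0 0 L).

(** The bag becomes [[q; p; y; z]], with the new fan vertex [q] adjacent to [p], [y] and [z]. One
    [L] hangs on [qp]; then [n] pairs of copies hang on [qy] and [qz], for trees stacked one after
    another on the same edge. *)
Fixpoint fan_step (j : nat) : recipe :=
  if j is j'.+1 then
    Select 0 0 1 2 (New (Par L (Select 0 2 3 0 (iter n (Par lights) (fan_step j')))))
  else Stop.

Definition fan (k j : nat) : recipe := iter k (Par lights) (fan_step j).

(** The new vertex is the next centre [z], adjacent to [p] and [y]. The fan of [y] starts at [p],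
    which is the previous centre or, at first, the other root vertex; the next spine has centre [z]
    and starts its fan at [y]. *)
Fixpoint spine (i : nat) : recipe :=
  if i is i'.+1 then
    Select 0 0 1 0 (New (Par (Select 1 2 0 0 (fan n n)) (Select 2 0 0 0 (spine i'))))
  else Stop.

(** Either end of the root edge may be the first centre of the heavy path. *)
Definition double_spine : recipe :=
  Par (Select 1 0 0 0 (spine n)) (Select 0 1 0 0 (spine n)).

Hypotheses (L_univ : universal h L) (n_le : n <= h.*2.+1).

Section Claims.
Variables (A : Type) (e : rel nat).
Hypothesis e_sym : symmetric e.
Implicit Types t : ltree A.

(* The second alternative leaves a smaller tree to be placed on the edge
   [z y] between the two next centres. *)
Lemma fan_fits t k j m p y z b :
  keeps_left h t -> weight t <= k -> weight t <= j -> weight t <= n ->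
  built e (fan k j) (p :: y :: z :: b) m -> e z p -> e z y ->
  fits e m (wsize (fan k j)) y p t \/
  exists t' u, [/\ weight t' < weight t, keeps_left h t',
    block m (m + wsize (fan k j)) u &
    forall v, place e z y t' v -> place e y p t (z :: u ++ v)].
Proof.
move: {2}(weight t) (leqnn (weight t)) => N.
elim: N t k j m p y z b => [|N IH] [|c l r s] k j m p y z b //.
  by left; exists [::].
  by left; exists [::].
rewrite [weight _]/= => leN dir le_k le_j le_n.
case: k le_k => // k le_k; set lw := wsize L.
have -> : wsize (fan k.+1 j) = lw + lw + wsize (fan k j) by [].
set wk := wsize (fan k j).
have [ltlN ltrN ltsN] : [/\ weight l <= N, weight r <= N & weight s <= N].
  by split; lia.
have [lel les] : weight l < n /\ weight s <= n by lia.
have [lek lej] : weight s <= k /\ weight s <= j by lia.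
move: dir; rewrite /=; case: ifP => lr dir [[Bs Br] Bfan] ezp ezy.
  (* The vertex [c] together with [l] and [r] is light: one copy of [L] on [yp] takes it, and the
     heavy path goes on in [s] at the same fan vertex. *)
  have le_lr : weight (Node c l r Leaf) <= h by rewrite /= addn0.
  have [u0 pu0 bu0] := L_univ e_sym Bs le_lr.
  have [[us ps bus]|[t' [u [st' dt' bu pu]]]] :=
    IH s _ _ _ _ _ _ _ ltsN dir lek lej les Bfan ezp ezy.
  - left; exists (u0 ++ us); first exact: place_Node.
    rewrite addnA; apply: block_cat bu0 bus; rewrite /= -/lw; lia.
  - right; exists t', (u0 ++ u); split=> //; first lia.
      rewrite addnA; apply: block_cat bu0 bu; rewrite /= -/lw; lia.
    move=> v /pu ps; apply: (perm_place _ (place_Node pu0 ps)).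
    by apply/permP => P; rewrite /= !count_cat /= count_cat; lia.
(* Since [l] and [r] weigh at least [h] together and the whole tree at most [2h+1], [s] weighs at
   most [h]; so does [r], the lighter of [l] and [r]. *)
have [sh rh] : weight s <= h /\ weight r <= h by lia.
have [us ps bus] := L_univ e_sym Bs sh.
have {}bus : block m (m + lw) us by [].
(* If the heavy path now leaves [y], then [c] is its next centre and goes to [z]: [r] is placed on
   [zp], [s] on [yp], and [l] is left over, flipped, for the edge [zy]. *)
have [dl|ndl] := boolP (keeps_left h l); last first.
  have [ur pr bur] := L_univ e_sym Br rh.
  have {}bur : block (m + lw) (m + lw + lw) ur by [].
  right; exists (flip l), (us ++ ur); split.
  - by rewrite weight_flip; lia.
  - exact: keeps_left_flip.
  - apply: block_cat (leqnn _) _ _ bus (block_widen (leqnn _) _ bur); lia.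
  - move=> v /place_flip pl; exists z, v, ur, us; split=> //.
    by apply/permP => P; rewrite /= !count_cat /=; lia.
(* Otherwise [c] becomes the next fan vertex [m'], and the remaining [k] pairs of light copies at
   [p] are skipped. *)
case: j le_j Bfan @wk {lej} => // j le_j /built_iter + wk.
rewrite [wsize lights]/= -/lw; set m' := m + _ + _.
have -> : wk = k * (lw + lw) + (lw + wsize (fan n j)).+1.
  by rewrite /wk wsize_iter.
set wf := wsize _; case=> em' [BL Bfan]; rewrite -/lw in BL Bfan.
have em'x x : x \in [:: p; y; z] -> e m' x by apply: em'.
have [ur pr bur] := L_univ e_sym BL rh.
have {}bur : block m'.+1 (m'.+1 + lw) ur by [].
have em'p : e m' p by apply: em'x; rewrite !inE eqxx.
have em'y : e m' y by apply: em'x; rewrite !inE eqxx orbT.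
have ezm' : e z m' by rewrite e_sym em'x // !inE eqxx !orbT.
have le_lj : weight l <= j by lia.
have glue u : block (m'.+1 + lw) (m'.+1 + lw + wf) u ->
    block m (m + (lw + lw + (k * (lw + lw) + (lw + wf).+1))) (us ++ m' :: ur ++ u).
  move=> bu; apply: block_insert bus bur bu; rewrite /m';
    move: (k * _) => kl; clear; lia.
have shuffle c' v1 v2 v3 : perm_eq (v1 ++ c' :: v2 ++ v3) (c' :: v3 ++ v2 ++ v1).
  by apply/permP => P; rewrite /= !count_cat /= !count_cat; clear; lia.
have [[ul pl bul]|[t' [u [st' dt' bu pu]]]] :=
  IH l _ _ _ _ _ _ _ ltlN dl (ltnW lel) le_lj (ltnW lel) Bfan ezm' ezy.
- left; exists (us ++ m' :: ur ++ ul); last exact: glue.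
  by exists m', ul, ur, us.
- right; exists t', (us ++ m' :: ur ++ u); split=> //; last 2 first.
  + exact: glue.
  + move=> v /pu pl; exists m', (z :: u ++ v), ur, us; split=> //.
    apply: (perm_trans (y := z :: (m' :: u ++ ur ++ us) ++ v)).
      by rewrite perm_cons perm_cat2r.
    by apply/permP => P; rewrite /= !count_cat /=; clear; lia.
  by apply: leq_trans st' _; clear; lia.
Qed.

(** Each fan either completes the embedding or hands a strictly lighter tree to the next centre, so
    [weight t] centres suffice. *)
Lemma spine_fits t i m p y b :
  keeps_left h t -> weight t <= i -> weight t <= n ->
  built e (spine i) (p :: y :: b) m -> fits e m (wsize (spine i)) y p t.
Proof.
elim: i t m p y b => [|i IH] t m p y b dt le_i le_n.
  by case: t dt le_i le_n => // *; exists [::].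
rewrite /= => -[em [Bfan Bsp]].
have emp : e m p by apply: em; rewrite !inE eqxx.
have emy : e m y by apply: em; rewrite !inE eqxx orbT.
have [[u pu bu]|] := fan_fits dt le_n le_n le_n Bfan emp emy.
  by exists u => //; apply: block_widen bu; lia.
case=> t' [u [st' dt' bu pu]].
have [||v pv bv] := IH t' _ _ _ _ dt' _ _ Bsp; try lia.
exists (m :: u ++ v); first exact: pu.
rewrite addnS; apply: block_cons; first by lia.
by apply: block_cat (leqnn _) _ _ bu (block_widen (leqnn _) _ bv); rewrite /=; lia.
Qed.

End Claims.

Lemma double_spine_universal : universal n double_spine.
Proof.
move=> A t e x y b m e_sym [B1 B2] le_n.
have [dt|ndt] := boolP (keeps_left h t).
  have [u pu bu] := spine_fits e_sym dt le_n le_n B1.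
  by exists u => //; apply: block_widen bu => //=; rewrite leq_add2l leq_addr.
have le_fn : weight (flip t) <= n by rewrite weight_flip.
have [u pu bu] := spine_fits e_sym (keeps_left_flip ndt) le_fn le_fn B2.
exists u; first exact: place_flip.
by apply: block_widen bu; rewrite /= ?leq_addr // addnA.
Qed.

(** The cubic factor comes from [2n] centres, [n] fan vertices for each of them, and about [2n]
    copies of [L] at each fan vertex. *)
Lemma wsize_double_spine :
  (wsize double_spine).+1 <= 8 * n.+1 ^ 3 * (wsize L).+1.
Proof.
clear n_le L_univ.
have step j : wsize (fan_step j) <= j * (1 + wsize L + n * (wsize L).*2).
  by elim: j => //= j IHj; rewrite wsize_iter /=; lia.
have sp i : wsize (spine i) = i * (wsize (fan n n)).+1.
  by elim: i => //= i ->; rewrite mulSn; lia.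
have fn : wsize (fan n n) <= n * (1 + (wsize L) + 2 * (n * (wsize L)) + 2 * (wsize L)).
  by rewrite wsize_iter /=; have := step n; nia.
rewrite /= sp; nia.
Qed.

End Spine.

Fixpoint universal_recipe (d : nat) : recipe :=
  if d is d'.+1 then double_spine (2 ^ d).-1 (universal_recipe d') else Stop.

(** For [h = 2^d - 1] the next value [2^(d+1) - 1] is exactly [2h+1], the most that a double spine
    can handle. *)
Lemma universal_recipeP d : universal (2 ^ d).-1 (universal_recipe d).
Proof.
elim: d => [|d IHd]; first by move=> A [|//] e x y b m _ _ _; exists [::].
apply: double_spine_universal IHd _; rewrite expnS.
by have := expn_gt0 2 d; lia.
Qed.

(** * Subgraphs and treewidth bounds from elimination orderings *)

Lemma treewidth_le (G : sgraph) (D : tree_decomposition G) k :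
  td_width D <= k -> treewidth G <= k.
Proof.
rewrite /treewidth; case: ex_minnP => w _ minw; apply: leq_trans.
by apply: minw; apply/asboolP; exists D.
Qed.

Lemma treewidthP (G : sgraph) k :
  treewidth G <= k -> exists D : tree_decomposition G, td_width D <= k.
Proof.
rewrite /treewidth; case: ex_minnP => w /asboolP[D <-] _ le_k.
by exists D.
Qed.

Lemma contains_subgraph_hom (U H : sgraph) (g : H -> U) :
  injective g -> (forall x y, adj x y -> adj (g x) (g y)) ->
  contains_subgraph U H.
Proof.
move=> g_inj g_hom.
pose e (x y : U) := [exists a, exists b, [&& g a == x, g b == y & adj a b]].
have eP a b : e (g a) (g b) = adj a b.
  apply/existsP/idP => [[a' /existsP[b' /and3P[]]]|ab].
    by move=> /eqP/g_inj -> /eqP/g_inj ->.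
  by exists a; apply/existsP; exists b; rewrite !eqxx.
have e_sym : symmetric e.
  have e_swap x y : e x y -> e y x.
    case/existsP=> a /existsP[b /and3P[/eqP<- /eqP<-]].
    by rewrite -eP => ab; move: ab; rewrite !eP adj_sym.
  by move=> x y; apply/idP/idP; apply: e_swap.
have e_sub x y : e x y -> [&& x \in g @: H, y \in g @: H & adj x y].
  case/existsP=> a /existsP[b /and3P[/eqP<- /eqP<- ab]].
  by rewrite !imset_f // g_hom.
exists (Subgraph e_sym e_sub).
have gP (x : Subgraph e_sym e_sub) : exists a, g a = val x.
  by have /imsetP[a _ ->] := valP x; exists a.
pose f x := sval (cid (gP x)); have gf x : g (f x) = val x by rewrite /f; case: cid.
exists f; last by move=> x y; rewrite -eP !gf.
exists (fun a => exist _ (g a) (imset_f g (isT : a \in H))) => [x|a].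
  by apply: val_inj; rewrite /= gf.
by apply: g_inj; rewrite gf.
Qed.

Section Elimination.
Variables (N : nat) (nb : nat -> seq nat) (par : nat -> nat).
Hypotheses (nb_lt : forall v x, x \in nb v -> x < v) (nb0 : nb 0 = [::]).
Hypotheses (par_lt : forall v, 0 < v < N -> par v < v).
Hypotheses (nb_par : forall v, 0 < v < N -> {subset nb v <= par v :: nb (par v)}).
Hypothesis nb_size : forall v, v < N -> size (nb v) <= 3.

(** Here [nb v] lists the earlier neighbours of [v], and [par v] is an earlier vertex that together
    with its own earlier neighbours covers them. *)
Definition elim_adj : rel 'I_N := fun u v => (val u \in nb v) || (val v \in nb u).

Lemma elim_adj_sym : symmetric elim_adj.
Proof. by move=> u v; rewrite /elim_adj orbC. Qed.

Lemma elim_adj_irrefl : irreflexive elim_adj.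
Proof. by move=> u; rewrite /elim_adj orbb; apply/negP => /nb_lt; rewrite ltnn. Qed.

Definition elim_graph : sgraph := SGraph elim_adj_sym elim_adj_irrefl.

Let up (u v : nat) := (0 < u) && (v == par u).
Let tadj : rel 'I_N := fun u v => up u v || up v u.

Let tadj_sym : symmetric tadj.
Proof. by move=> u v; rewrite /tadj orbC. Qed.

Let up_lt (u v : 'I_N) : up u v -> v < u.
Proof. by case/andP=> u0 /eqP->; rewrite par_lt // u0 /=. Qed.

Let tadj_irrefl : irreflexive tadj.
Proof. by move=> u; rewrite /tadj orbb; apply/negP => /up_lt; rewrite ltnn. Qed.

Let tree : sgraph := SGraph tadj_sym tadj_irrefl.

Let connect_up (A : {set tree}) (r : tree) :
  (forall t : tree, t \in A -> t != r ->
     exists2 t' : tree, t' \in A & up t t') ->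
  connected_in A.
Proof.
move=> Aup; pose e := [rel a b : tree | [&& a \in A, b \in A & adj a b]].
have e_sym : symmetric e.
  by move=> a b; rewrite /= tadj_sym; case: (a \in A); case: (b \in A).
suff to_r t : t \in A -> connect e t r.
  move=> x y xA yA; apply: connect_trans (to_r x xA) _.
  by rewrite (sym_connect_sym e_sym) to_r.
have [k] := ubnP (val t); elim: k t => // k IHk t lt_k tA.
have [->|tr] := eqVneq t r; first exact: connect0.
have [t' t'A tt'] := Aup t tA tr.
apply: (connect_trans (y := t')).
  by apply: connect1; rewrite /= tA t'A /tadj tt'.
by apply: IHk => //; apply: leq_trans (up_lt tt') _.
Qed.

Lemma elim_tree : 0 < N -> is_tree tree.
Proof.
move=> N0; split; first by rewrite card_ord.
  apply: (connect_up (r := Ordinal N0)) => t _ t0.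
  have t_gt0 : 0 < t by rewrite lt0n; apply: contraNneq t0 => t0; apply/eqP/val_inj.
  have pt : par t < N by apply: ltn_trans (ltn_ord t); rewrite par_lt // t_gt0 /=.
  by exists (Ordinal pt); rewrite ?inE // /up t_gt0 /=.
move=> c c2 /andP[cyc uc].
have [x0 x0c] : exists x0, x0 \in c by case: c c2 {cyc uc} => // x0 c; exists x0; rewrite inE eqxx.
(* Both neighbours on the cycle of its largest vertex [M] are smaller than [M], hence equal to
   [par M], although the cycle has no repetition. *)
pose M := [arg max_(x > x0 | x \in c) (x : nat)].
have [Mc Mmax] : M \in c /\ forall x, x \in c -> x <= M.
  by rewrite /M; case: arg_maxnP.
have below x : x \in c -> tadj M x -> val x = par M.
  move=> xc /orP[/andP[_ /eqP]//|/up_lt]; have := Mmax x xc.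
  by rewrite leqNgt => /negbTE ->.
have [i s def_c] := rot_to Mc.
rewrite -(size_rot i) -(rot_cycle i) -(rot_uniq i) def_c in c2 cyc uc.
have sub x : x \in s -> x \in c.
  by move=> xs; rewrite -(mem_rot i) def_c inE xs orbT.
case: s def_c c2 cyc uc sub => [|a s] //; case/lastP: s => [|s z] // _ _ cyc uc sub.
move: cyc uc; rewrite /= rcons_path last_rcons mem_rcons inE.
case/and3P=> Ma _ zM /and3P[_ /norP[/eqP az _] _].
case: az; apply: val_inj; rewrite /= (below a) ?(below z) //.
- by apply: sub; rewrite inE mem_rcons inE eqxx orbT.
- by rewrite tadj_sym.
- by apply: sub; rewrite inE eqxx.
Qed.

(** The vertices themselves serve as tree nodes, with bags [t :: nb t]. Climbing along [par] from a
    bag that contains [v], one keeps [v] in the bag until the node [v] is reached. *)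
Lemma elim_treewidth : treewidth elim_graph <= 3.
Proof.
have [N0|N_gt0] := posnP N.
  apply: (@treewidth_le _ (trivial_td elim_graph)).
  rewrite /td_width -[3]/(4.-1); apply: (leq_trans _ (_ : 0 <= 3)) => //.
  suff -> : \max_(t : td_tree (trivial_td elim_graph)) #|td_bag t| = 0 by [].
  apply: big1 => t _; apply: eq_card0 => -[v lt_v]; exfalso.
  by rewrite N0 in lt_v.
pose bag (t : tree) : {set elim_graph} := [set v : 'I_N | val v \in val t :: nb t].
have cover v : exists t, v \in bag t by exists v; rewrite inE mem_head.
have edge (u v : elim_graph) : adj u v -> exists t, (u \in bag t) && (v \in bag t).
  case/orP=> uv; [exists v | exists u]; rewrite !inE eqxx uv ?orbT //.
have conn v : connected_in [set t | v \in bag t].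
  apply: (connect_up (r := v)) => t; rewrite !inE.
  case/orP=> [/eqP/val_inj->|vt tv]; first by rewrite eqxx.
  have t_gt0 : 0 < t by case: (val t) vt => //; rewrite nb0.
  have t_ran : 0 < t < N by rewrite t_gt0 /=.
  have pt : par t < N by apply: ltn_trans (ltn_ord t); rewrite par_lt.
  exists (Ordinal pt); last by rewrite /up t_gt0 /=.
  by rewrite !inE; have := nb_par t_ran vt; rewrite inE.
pose D := @TreeDecomposition elim_graph tree (elim_tree N_gt0) bag cover edge conn.
apply: (@treewidth_le _ D); rewrite /td_width -subn1 leq_subLR; apply/bigmax_leqP => t _.
apply: leq_trans (_ : size (val t :: nb t) <= 4); last exact: nb_size.
rewrite cardE -(size_map val); apply: uniq_leq_size.
  by rewrite (map_inj_uniq val_inj) enum_uniq.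
by move=> x /mapP[v]; rewrite mem_enum inE => ? ->.
Qed.

End Elimination.

(** * The graph of a recipe *)

Section Hom.
Variable A : eqType.
Implicit Types t : ltree A.

Fixpoint same_shape (A B : Type) (t : ltree A) (t' : ltree B) : Prop :=
  match t, t' with
  | Leaf, Leaf => True
  | Node _ l r s, Node _ l' r' s' =>
      [/\ same_shape l l', same_shape r r' & same_shape s s']
  | _, _ => False
  end.

Fixpoint tmap (A B : Type) (f : A -> B) (t : ltree A) : ltree B :=
  if t is Node c l r s then Node (f c) (tmap f l) (tmap f r) (tmap f s)
  else Leaf.

Lemma same_shape_weight (B : Type) t (t' : ltree B) :
  same_shape t t' -> weight t = weight t'.
Proof.
elim: t t' => [|c l IHl r IHr s IHs] [|c' l' r' s'] //=.
by case=> /IHl-> /IHr-> /IHs->.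
Qed.

Lemma same_shape_tmap (B : Type) (f : A -> B) t (t' : ltree B) :
  same_shape t t' -> labels t' = map f (labels t) -> t' = tmap f t.
Proof.
elim: t t' => [|c l IHl r IHr s IHs] [|c' l' r' s'] //= [sl sr ss] [-> eq_lab].
have szl : size (labels l') = size (map f (labels l)).
  by rewrite size_map !size_labels (same_shape_weight sl).
have szr : size (labels r') = size (map f (labels r)).
  by rewrite size_map !size_labels (same_shape_weight sr).
rewrite !map_cat in eq_lab.
have eq_l : labels l' = map f (labels l).
  by have := congr1 (take (size (labels l'))) eq_lab; rewrite {2}szl !take_size_cat.
have eq_rs : labels r' ++ labels s' = map f (labels r) ++ map f (labels s).
  by have := congr1 (drop (size (labels l'))) eq_lab; rewrite {2}szl !drop_size_cat.
have eq_r : labels r' = map f (labels r).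
  by have := congr1 (take (size (labels r'))) eq_rs; rewrite {2}szr !take_size_cat.
have eq_s : labels s' = map f (labels s).
  by have := congr1 (drop (size (labels r'))) eq_rs; rewrite {2}szr !drop_size_cat.
by rewrite -(IHl l') -?(IHr r') -?(IHs s').
Qed.

Lemma edges_tmap (B : Type) (f : A -> B) a b t :
  edges (f a) (f b) (tmap f t) = [seq (f p.1, f p.2) | p <- edges a b t].
Proof. by elim: t a b => //= c l IHl r IHr s IHs a b; rewrite !map_cat IHl IHr IHs. Qed.

Lemma place_ltree e x y t u : symmetric e -> e x y -> place e x y t u ->
  exists t' : ltree nat, [/\ same_shape t t', perm_eq u (labels t') &
    all (fun p => e p.1 p.2) (edges x y t')].
Proof.
move=> e_sym; elim: t x y u => [|c l IHl r IHr s IHs] x y u exy /=.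
  by move=> ->; exists Leaf; rewrite /= exy.
case=> c' [ul [ur [us [pu ex ey [pl pr ps]]]]].
have exc : e x c' by rewrite e_sym.
have [l' [shl pl' el]] := IHl _ _ _ exc pl.
have [r' [shr pr' er]] := IHr _ _ _ ey pr.
have [s' [shs ps' es]] := IHs _ _ _ exy ps.
exists (Node c' l' r' s'); split=> //=; last by rewrite !all_cat el er.
apply: perm_trans pu _; rewrite perm_cons.
by rewrite !perm_cat.
Qed.

(** The placement yields a tree [t'] of the same shape labelled by the images; sending labels of [t]
    to those of [t'] position by position turns [t'] into the image of [t], edges included. *)
Lemma place_hom e x y a b t u : symmetric e -> e x y -> place e x y t u ->
    uniq (x :: y :: u) -> uniq (a :: b :: labels t) ->
  exists f : A -> nat,
    [/\ {in a :: b :: labels t &, injective f},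
        {in a :: b :: labels t, forall v, f v \in x :: y :: u} &
        {in edges a b t, forall p, e (f p.1) (f p.2)}].
Proof.
move=> e_sym exy pl ux ua; have [t' [sh pu et']] := place_ltree e_sym exy pl.
pose s := a :: b :: labels t; pose s' := x :: y :: labels t'.
have ps : perm_eq (x :: y :: u) s' by rewrite !perm_cons.
have us' : uniq s' by rewrite -(perm_uniq ps).
have sz : size s = size s' by rewrite /= !size_labels (same_shape_weight sh).
pose f v := nth 0 s' (index v s).
have fs : map f s = s'.
  apply: (@eq_from_nth _ 0) => [|i]; rewrite size_map // => lt_i.
  by rewrite (nth_map a) // /f index_uniq.
have inds v : v \in s -> index v s < size s' by rewrite -sz index_mem.
case: (fs) => fa fb fl.
exists f; split=> [v w vs ws /eqP|v vs|p].
- by rewrite nth_uniq ?inds // => /eqP idx; rewrite -(nth_index a vs) idx nth_index.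
- by rewrite (perm_mem ps) mem_nth ?inds.
- move: et'; rewrite -fa -fb (same_shape_tmap sh (esym fl)) edges_tmap.
  by rewrite all_map => /allP; apply.
Qed.

End Hom.

Section Code.

(** Lists, for the new vertices [m], [m+1], ..., the pairs [(par v, nb v)] of an elimination
    ordering. The parent [q] is the latest vertex created on the way to the bag [b]. *)
Fixpoint code (w : recipe) (q : nat) (b : seq nat) (m : nat) : seq (nat * seq nat) :=
  match w with
  | Stop => [::]
  | Par w1 w2 => code w1 q b m ++ code w2 q b (m + wsize w1)
  | Select i j k l w => code w q (select_bag i j k l b) m
  | New w => (q, behead b) :: code w m (m :: behead b) m.+1
  end.

Lemma size_code w q b m : size (code w q b m) = wsize w.
Proof.
elim: w q b m => //= [w1 IH1 w2 IH2 | w IHw] q b m; last by rewrite IHw.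
by rewrite size_cat IH1 IH2.
Qed.

Variable c : nat -> nat * seq nat.
Notation nb v := (c v).2.
Notation par v := (c v).1.

Definition code_at (w : recipe) q b m :=
  forall i, i < wsize w -> c (m + i) = nth (0, [::]) (code w q b m) i.

Lemma code_at_Par1 w1 w2 q b m : code_at (Par w1 w2) q b m -> code_at w1 q b m.
Proof.
move=> cw i lt_i; rewrite cw /= ?nth_cat ?size_code ?lt_i //.
exact: leq_trans (leq_addr _ _).
Qed.

Lemma code_at_Par2 w1 w2 q b m :
  code_at (Par w1 w2) q b m -> code_at w2 q b (m + wsize w1).
Proof.
move=> cw i lt_i; rewrite -addnA cw /= ?ltn_add2l // nth_cat size_code.
by rewrite ltnNge leq_addr addKn.
Qed.

Lemma code_at_New w q b m : code_at (New w) q b m ->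
  c m = (q, behead b) /\ code_at w m (m :: behead b) m.+1.
Proof.
move=> cw; split; first by have := cw 0 isT; rewrite addn0.
by move=> i lt_i; rewrite addSnnS cw.
Qed.

Lemma code_at_built w q b m :
  code_at w q b m ->
  built (fun u v => (u \in nb v) || (v \in nb u)) w b m.
Proof.
elim: w q b m => //= [w1 IH1 w2 IH2 | i j k l w IHw | w IHw] q b m cw.
- by split; [exact: IH1 (code_at_Par1 cw) | exact: IH2 (code_at_Par2 cw)].
- exact: IHw cw.
- have [cm cw'] := code_at_New cw; split; last exact: IHw cw'.
  by move=> x xb; rewrite cm xb orbT.
Qed.

Lemma select_bag_sub i j k l b : b != [::] -> {subset select_bag i j k l b <= b}.
Proof.
case: b => // a b _ x /mapP[z _ ->].
have [lt_z|le_z] := ltnP z (size (a :: b)); first exact: mem_nth.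
by rewrite [nth _ _ _]nth_default // mem_head.
Qed.

(** The invariant is that the bag lies in [q :: nb q]. A new vertex [m] has [nb m = behead b], so
    its bag is exactly [m :: nb m], and dropping the first of at most four vertices leaves three
    neighbours. *)
Lemma code_at_elim w q b m :
    code_at w q b m -> b != [::] -> size b <= 4 -> q < m ->
    {subset b <= q :: nb q} -> {in b, forall x, x < m} ->
  forall v, m <= v < m + wsize w ->
  [/\ par v < v, {subset nb v <= par v :: nb (par v)}, size (nb v) <= 3 &
      {in nb v, forall x, x < v}].
Proof.
elim: w q b m => [|w1 IH1 w2 IH2|i j k l w IHw|w IHw] q b m cw bn szb qm sub_b b_lt v /=.
- by lia.
- move=> v_ran; have [v1|v2] := ltnP v (m + wsize w1).
    by apply: (IH1 _ _ _ (code_at_Par1 cw)) => //; lia.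
  apply: (IH2 _ _ _ (code_at_Par2 cw)) => //; try lia.
  by move=> x /b_lt; lia.
- have sub_p := @select_bag_sub i j k l b bn.
  by apply: (IHw _ _ _ cw) => // x /sub_p; [exact: sub_b | exact: b_lt].
- have [cm cw'] := code_at_New cw; move=> v_ran.
  have sub_bb : {subset behead b <= b} by move=> x /mem_behead.
  have [->|vm] := eqVneq v m.
    rewrite cm /=; split=> // [x /sub_bb /sub_b //||x /sub_bb /b_lt //].
    by rewrite size_behead; lia.
  apply: (IHw _ _ _ cw') => //; last lia.
  + by rewrite /= size_behead; lia.
  + by move=> x; rewrite cm.
  + by move=> x; rewrite inE => /orP[/eqP->//|/sub_bb/b_lt]; lia.
Qed.

End Code.

Lemma recipe_graph (w : recipe) :
  exists (N : nat) (e : rel nat) (U : sgraph) (i : U -> nat),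
  [/\ N = (wsize w).+2, symmetric e, e 0 1, built e w [:: 0; 1] 2 &
   [/\ injective i, forall v, v < N -> exists x, i x = v,
       forall x y, adj x y = e (i x) (i y), #|U| = N & treewidth U <= 3]].
Proof.
(* The first two entries make 0 and 1 the root edge; numbers beyond the list get no neighbours by
   default. *)
pose full := (0, [::]) :: (0, [:: 0]) :: code w 1 [:: 0; 1] 2.
pose c v := nth (0, [::]) full v.
have cw : code_at c w 1 [:: 0; 1] 2 by [].
pose N := (wsize w).+2.
have szf : size full = N by rewrite /= size_code.
have spec v : 0 < v < N ->
  [/\ (c v).1 < v, {subset (c v).2 <= (c v).1 :: (c (c v).1).2},
      size (c v).2 <= 3 & {in (c v).2, forall x, x < v}].
  case: v => [|[|v]] // lt_v.
    by rewrite /c /=; split=> // x; rewrite !inE // => /eqP->.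
  apply: (code_at_elim cw) => //; first by move=> x; rewrite /c /= !inE orbC.
  by move=> x; rewrite !inE => /orP[] /eqP->.
have nb0 : (c 0).2 = [::] by [].
have nb_lt v x : x \in (c v).2 -> x < v.
  case: (posnP v) => [->//|v0].
  have [lt_v|le_v] := ltnP v N; last by rewrite /c nth_default ?szf.
  by have [|_ _ _] := spec v; [rewrite v0 | exact].
exists N, (fun u v => (u \in (c v).2) || (v \in (c u).2)), (@elim_graph N _ nb_lt), val.
split=> //; first by move=> u v; rewrite orbC.
  exact: code_at_built cw.
split=> //.
- exact: val_inj.
- by move=> v lt_v; exists (Ordinal lt_v).
- exact: card_ord.
- apply: (@elim_treewidth N _ (fun v => (c v).1)) => // v.
  + by case/spec.
  + by case/spec.
  + by case: (posnP v) => [->|v0] //; move=> lt_v; have [|] := spec v; rewrite ?v0.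
Qed.

(** * From treewidth at most 2 to ternary trees *)

Section Insertion.
Variable A : eqType.
Implicit Types (t : ltree A).

Definition joined a b t x y := ((x, y) \in edges a b t) || ((y, x) \in edges a b t).

Lemma mem_edges_root a b t : (a, b) \in edges a b t.
Proof.
by elim: t a b => [|c l _ r _ s IHs] a b /=; rewrite ?mem_head // !mem_cat IHs !orbT.
Qed.

(** Every edge sits at a leaf of the tree; that leaf is replaced by a node for [v]. *)
Lemma edges_insert a b t x y v : (x, y) \in edges a b t ->
  exists t', [/\ perm_eq (labels t') (v :: labels t),
    {subset edges a b t <= edges a b t'},
    (x, v) \in edges a b t' & (v, y) \in edges a b t'].
Proof.
elim: t a b => [|c l IHl r IHr s IHs] a b /=.
  rewrite inE => /eqP[-> ->]; exists (Node v Leaf Leaf Leaf) => /=.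
  split=> // [p||]; rewrite !inE ?eqxx ?orbT //.
  by move=> ->; rewrite !orbT.
rewrite !mem_cat => /or3P[/IHl|/IHr|/IHs] [t' [pt st xt yt]].
- exists (Node c t' r s); split=> /=; rewrite ?mem_cat ?xt ?yt ?orbT //.
    apply/permP => P; move/permP/(_ P): pt => /=.
    by rewrite !count_cat => ->; lia.
  by move=> p; rewrite !mem_cat => /or3P[/st|->|->]; rewrite ?orbT // => ->.
- exists (Node c l t' s); split=> /=; rewrite ?mem_cat ?xt ?yt ?orbT //.
    apply/permP => P; move/permP/(_ P): pt => /=.
    by rewrite !count_cat => ->; lia.
  by move=> p; rewrite !mem_cat => /or3P[->|/st|->]; rewrite ?orbT // => ->; rewrite ?orbT.
- exists (Node c l r t'); split=> /=; rewrite ?mem_cat ?xt ?yt ?orbT //.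
    apply/permP => P; move/permP/(_ P): pt => /=.
    by rewrite !count_cat => ->; lia.
  by move=> p; rewrite !mem_cat => /or3P[->|->|/st]; rewrite ?orbT // => ->; rewrite !orbT.
Qed.

Lemma joined_insert a b t x y v : joined a b t x y ->
  exists t', [/\ perm_eq (labels t') (v :: labels t),
    forall x' y', joined a b t x' y' -> joined a b t' x' y',
    joined a b t' x v & joined a b t' v y].
Proof.
rewrite /joined => /orP[] /(@edges_insert _ _ _ _ _ v)[t' [pt st xt yt]];
  exists t'; split=> // [x' y'||]; rewrite ?xt ?yt ?orbT //;
  by case/orP=> /st->; rewrite ?orbT.
Qed.

Lemma joined_exists a b t x : x \in a :: b :: labels t -> exists y, joined a b t x y.
Proof.
rewrite !inE => /or3P[/eqP->|/eqP->|].
- by exists b; rewrite /joined mem_edges_root.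
- by exists a; rewrite /joined mem_edges_root orbT.
elim: t a b => //= c l IHl r IHr s IHs a b.
rewrite inE !mem_cat => /or4P[/eqP->|/(IHl a c)|/(IHr c b)|/(IHs a b)].
- by exists a; rewrite /joined !mem_cat mem_edges_root orbT.
- by case=> y /orP[] yl; exists y; rewrite /joined !mem_cat yl ?orbT.
- by case=> y /orP[] yl; exists y; rewrite /joined !mem_cat yl ?orbT.
- by case=> y /orP[] yl; exists y; rewrite /joined !mem_cat yl ?orbT.
Qed.

Variable sh : rel A.
Hypothesis sh_sym : symmetric sh.

(* [s] lists the vertices in a perfect elimination ordering of width 2. *)
Fixpoint two_elim (s : seq A) : Prop :=
  if s is v :: s' then
    [/\ v \notin s', count (sh v) s' <= 2,
        {in s' &, forall x y, sh v x -> sh v y -> sh x y} & two_elim s']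
  else True.

Lemma two_elim_uniq (s : seq A) : two_elim s -> uniq s.
Proof. by elim: s => //= v s IHs [-> _ _ /IHs]. Qed.

(** The vertices are stacked in reverse order: the at most two later neighbours of [v] form a
    clique, so some edge of the 2-tree built so far contains them, and [v] goes on it. *)
Lemma two_elim_ltree (s : seq A) : 1 < size s -> two_elim s ->
  exists a b t, perm_eq (a :: b :: labels t) s /\
    {in s &, forall x y, x != y -> sh x y -> joined a b t x y}.
Proof.
elim: s => // v s IHs; case: s IHs => // w [|z s] IHs _.
  move=> _; exists v, w, Leaf; split=> // x y.
  rewrite !inE => /orP[]/eqP-> /orP[]/eqP->; rewrite ?eqxx // /joined /= !inE eqxx ?orbT //.
set s0 := w :: z :: s in IHs *; case=> v_s0 cnt cl te; have {}te : two_elim s0 by [].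
have us0 := two_elim_uniq te.
have [a [b [t [pt jt]]]] := IHs isT te.
have mem_t x : (x \in a :: b :: labels t) = (x \in s0) by rewrite (perm_mem pt).
have finish x y : joined a b t x y -> {in s0, forall u, sh v u -> u = x \/ u = y} ->
  exists a0 b0 t0, perm_eq (a0 :: b0 :: labels t0) (v :: s0) /\
    {in v :: s0 &, forall x y, x != y -> sh x y -> joined a0 b0 t0 x y}.
  move=> /(@joined_insert _ _ _ _ _ v)[t' [pt' mono xv vy]] sub.
  have to_v u : u \in s0 -> sh v u -> joined a b t' u v.
    move=> us /(sub u us)[]-> //.
    by rewrite /joined orbC.
  exists a, b, t'; split.
    apply/permP => P; have := permP pt P; have := permP pt' P.
    by rewrite /= => -> <-; clear; lia.
  move=> x' y'; rewrite !(in_cons v) => /orP[/eqP->|xs] /orP[/eqP->|ys].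
  - by rewrite eqxx.
  - by move=> _ vy'; rewrite /joined orbC; apply: to_v.
  - by move=> _; rewrite sh_sym => vx; rewrite to_v.
  - by move=> neq /(jt _ _ xs ys neq)/mono.
pose N := [seq u <- s0 | sh v u].
have memN u : (u \in N) = (sh v u && (u \in s0)) by rewrite mem_filter.
have szN : size N <= 2 by rewrite size_filter.
have uN : uniq N by apply: filter_uniq.
case defN : N szN uN memN => [|x [|y []]] // _ uN memN.
- have /joined_exists[y wy] : w \in a :: b :: labels t by rewrite mem_t mem_head.
  by apply: finish wy _ => u us vu; have := memN u; rewrite vu us.
- have [vx xs] : sh v x /\ x \in s0 by apply/andP; rewrite -memN mem_head.
  have /joined_exists[y xy] : x \in a :: b :: labels t by rewrite mem_t.
  by apply: finish xy _ => u us vu; left; have := memN u; rewrite vu us inE => /eqP.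
- have [vx xs] : sh v x /\ x \in s0 by apply/andP; rewrite -memN mem_head.
  have [vy ys] : sh v y /\ y \in s0.
    by apply/andP; rewrite -memN !inE eqxx orbT.
  have neq : x != y by move: uN; rewrite /= inE => /andP[].
  apply: finish (jt _ _ xs ys neq (cl _ _ xs ys vx vy)) _ => u us vu.
  have := memN u; rewrite vu us !inE => /orP[/eqP->|/eqP->]; by [left|right].
Qed.

End Insertion.

(** * Rooting a tree by parents and depths *)

Section Rooting.
Variable T : sgraph.
Hypothesis T_tree : is_tree T.

Local Notation adjT := (@adj T).

Lemma tree_connect (x y : T) : connect adjT x y.
Proof.
case: T_tree => _ /(_ x y (in_setT x) (in_setT y)) + _.
by rewrite (@eq_connect _ _ adjT) // => a b; rewrite /= !in_setT.
Qed.

Lemma root_exists : exists r : T, True.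
Proof. by case: T_tree => /card_gt0P[r _] _ _; exists r. Qed.

Variable r : T.

Definition avoiding (t : T) : rel T := [rel a b | [&& a != t, b != t & adjT a b]].

Definition towards (t u : T) : bool := adjT t u && connect (avoiding t) u r.

Lemma avoiding_sym t : symmetric (avoiding t).
Proof. move=> a b; by rewrite /avoiding /= adj_sym andbCA. Qed.

Lemma avoiding_path t x p : x != t -> path adjT x p -> t \notin p -> path (avoiding t) x p.
Proof.
elim: p x => //= y p IHp x xt /andP[xy pth]; rewrite inE negb_or eq_sym => /andP[yt tp].
by rewrite /avoiding /= xt yt xy IHp.
Qed.

Lemma path_avoiding t x p : path (avoiding t) x p -> path adjT x p /\ t \notin p.
Proof.
elim: p x => //= y p IHp x /andP[/and3P[_ yt xy] /IHp[pth tp]].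
by rewrite xy pth inE negb_or eq_sym yt tp.
Qed.

(* Two neighbours of [t] joined by a path avoiding [t] would close a cycle. *)
Lemma towards_inj t u v : towards t u -> towards t v -> u = v.
Proof.
case/andP=> tu cu /andP[tv cv]; apply/eqP; apply: contraT => uv.
have : connect (avoiding t) u v.
  apply: connect_trans cu _; rewrite sym_connect_sym //; exact: avoiding_sym.
case/connectP=> p0 /shortenP[p pth up _] def_v.
have [pth' tp] := path_avoiding pth.
case: T_tree => _ _ /(_ (t :: u :: p)); case; first by case: p def_v {pth up pth' tp} => //= def_v; rewrite def_v eqxx in uv.
have tu' : t != u by apply: contraTneq tu => ->; rewrite adj_irrefl.
rewrite /ucycle (cons_uniq t) inE negb_or tu' tp up !andbT.
by rewrite /= rcons_path tu pth' -def_v adj_sym.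
Qed.

(** A simple path from [t] to [r] either visits [u], and then its tail from [u] avoids [t], or
    avoids [u] altogether. *)
Lemma adj_towards t u : adj t u -> towards t u \/ towards u t.
Proof.
move=> tu.
case/connectP: (tree_connect t r) => p0 /shortenP[p pth up _] def_r.
have [u_p|u_p] := boolP (u \in p).
  left; rewrite /towards tu.
  move: up pth def_r; case/splitPr: u_p => p1 p2.
  rewrite cat_path last_cat /= => /andP[tp _] /and3P[_ _ pth] def_r.
  apply/connectP; exists p2 => //; apply: avoiding_path => //.
    by apply: contraTneq tu => ->; rewrite adj_irrefl.
  by apply: contra tp => tp2; rewrite mem_cat inE tp2 !orbT.
right; rewrite /towards adj_sym tu; apply/connectP; exists p => //.
apply: avoiding_path => //.
by apply: contraTneq tu => ->; rewrite adj_irrefl.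
Qed.

Lemma towards_first t u p : last u p = r -> path adjT t (u :: p) -> uniq (t :: u :: p) ->
  towards t u.
Proof.
move=> lp /= /andP[tu pth] /andP[tp _]; rewrite /towards tu.
move: tp; rewrite inE negb_or => /andP[tu' tp].
by apply/connectP; exists p => //; apply: avoiding_path; rewrite // eq_sym.
Qed.

Lemma tree_rooting : exists (par : T -> T) (depth : T -> nat),
  (forall t, par t != t -> depth (par t) < depth t) /\
  (forall t u, adj t u -> u = par t \/ t = par u).
Proof.
pose P t k := `[< exists p, [/\ path adjT t p, last t p = r & size p = k] >].
have exP t : exists k, P t k.
  have /connectP[p pth rp] := tree_connect t r.
  by exists (size p); apply/asboolP; exists p.
pose par t := if [pick u | towards t u] is Some u then u else t.
have parE t u : towards t u -> par t = u.
  move=> tu; rewrite /par; case: pickP => [v tv|/(_ u)]; last by rewrite tu.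
  exact: towards_inj tv tu.
exists par, (fun t => ex_minn (exP t)); split=> [t|t u]; last first.
  by case/adj_towards => /parE ->; [left | right].
rewrite {1}/par; case: pickP => [u tu _|]; last by rewrite eqxx.
rewrite (parE _ _ tu); case: (ex_minnP (exP t)) => k /asboolP[p0 [pth0 lp0 <-]] _.
case: ex_minnP => m _ min_m.
move: lp0; case/shortenP: pth0 => p pth up sub_p lp.
(* The root has no neighbour towards itself, since a path ending in [r] cannot avoid [r]. *)
have tr : t != r.
  apply: contraTneq tu => ->; rewrite /towards; apply/negP => /andP[ru /connectP[q]].
  move=> /path_avoiding[_ rq] def_r; move: rq; case: q def_r => [|x q] /= def_r.
    by rewrite -def_r adj_irrefl in ru.
  by rewrite def_r mem_last.
case: p pth up sub_p lp => [|v p] pth up sub_p lp; first by rewrite -lp eqxx in tr.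
have tv := @towards_first t v p lp pth up; rewrite (towards_inj tu tv) in min_m.
apply: leq_trans (_ : size (v :: p) <= size p0); last first.
  by apply: uniq_leq_size sub_p; case/andP: up.
rewrite ltnS; apply: min_m; apply/asboolP; exists p; split=> //.
by case/andP: pth.
Qed.

End Rooting.

(** * Elimination ordering from a rooted tree decomposition *)

Section Tops.
Variables (H : sgraph) (D : tree_decomposition H).
Let T := td_tree D.
Variables (par : T -> T) (depth : T -> nat).
Hypothesis depth_par : forall t, par t != t -> depth (par t) < depth t.
Hypothesis adj_par : forall t u : T, adj t u -> u = par t \/ t = par u.

Lemma depth_iter k t : iter k par t = t \/ depth (iter k par t) < depth t.
Proof.
elim: k => [|k IHk] /=; first by left.
have [->|/depth_par lt_d] := eqVneq (par (iter k par t)) (iter k par t); first exact: IHk.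
by right; case: IHk lt_d => [->//|lt_t lt_d]; apply: ltn_trans lt_d lt_t.
Qed.

Lemma exists_top v : exists2 t0 : T, v \in td_bag t0 &
  forall t, v \in td_bag t -> exists2 k, iter k par t = t0 &
    forall j, j <= k -> v \in td_bag (iter j par t).
Proof.
have [t1 vt1] := td_vertex D v.
case: (@arg_minnP T t1 (fun t => v \in td_bag t) depth vt1) => t0 vt0 min_t0.
exists t0 => // t vt.
have := @td_connected _ D v t t0; rewrite !inE => /(_ vt vt0) /connectP[p].
elim: p t vt => [|t' p IHp] t vt /=; first by move=> _ <-; exists 0 => // -[].
case/andP=> /and3P[_]; rewrite !inE => vt' tt' pth t0p.
have [k kt0 vk] := IHp t' vt' pth t0p; case: (adj_par tt') => [def_t'|def_t].
  exists k.+1; first by rewrite iterSr -def_t'.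
  by case=> [|j] // le_j; rewrite iterSr -def_t' vk.
case: k kt0 vk => [|k] kt0 vk; last first.
  exists k; first by rewrite -kt0 iterSr -def_t.
  by move=> j le_j; rewrite def_t -iterSr vk.
exists 0; last by case.
move: kt0 def_t => /= -> def_t; rewrite def_t; apply/eqP.
by apply: contraT => /depth_par; rewrite ltnNge min_t0 // -def_t.
Qed.

Definition top v : T := s2val (cid2 (exists_top v)).

Lemma top_bag v : v \in td_bag (top v).
Proof. exact: s2valP (cid2 (exists_top v)). Qed.

Lemma topP v t : v \in td_bag t -> exists2 k, iter k par t = top v &
    forall j, j <= k -> v \in td_bag (iter j par t).
Proof. exact: (s2valP' (cid2 (exists_top v))). Qed.

(** The chordal completion of [H] given by the decomposition, with loops: every bag becomes a
    clique. *)
Definition share : rel H :=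
  fun u v => [exists t : T, (u \in td_bag t) && (v \in td_bag t)].

Lemma share_sym : symmetric share.
Proof. by move=> u v; apply: eq_existsb => t; rewrite andbC. Qed.

(** Climbing from a common node, one meets both tops. Either [top v] comes no later than [top u],
    while [u] is still in the bags, or it comes later, and then the depths force the two to
    coincide. *)
Lemma share_top u v : share u v -> depth (top u) <= depth (top v) -> u \in td_bag (top v).
Proof.
case/existsP=> t /andP[/topP[i iu ui] /topP[j jv vj]] le_d.
have [le_ji|lt_ij] := leqP j i; first by rewrite -jv ui.
have top_v : top v = iter (j - i) par (top u) by rewrite -iu -iterD subnK // ltnW.
case: (depth_iter (j - i) (top u)); rewrite -top_v; first by move=> ->; exact: top_bag.
by rewrite ltnNge le_d.
Qed.

(** The later neighbours of [v] all lie in the bag of [top v], so they form a clique; that bag also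
    contains [v], which leaves room for two of them. *)
Lemma two_elim_sorted (s : seq H) : (forall t : T, #|td_bag t| <= 3) ->
  uniq s -> sorted (fun u v => depth (top v) <= depth (top u)) s -> two_elim share s.
Proof.
move=> bag3; elim: s => //= v s IHs /andP[vs us] pth.
have le_trans : transitive (fun u v => depth (top v) <= depth (top u)).
  by move=> y x z xy yz; apply: leq_trans yz xy.
have key := allP (order_path_min le_trans pth).
have in_top x : x \in s -> share v x -> x \in td_bag (top v).
  by move=> xs; rewrite share_sym => /share_top; apply; apply: key.
split=> //.
- rewrite -ltnS; apply: leq_trans (bag3 (top v)).
  rewrite -size_filter -[_.+1]/(size (v :: _)) cardE; apply: uniq_leq_size.
    by rewrite /= mem_filter (negbTE vs) andbF filter_uniq.
  move=> x; rewrite mem_enum inE mem_filter => /orP[/eqP->|/andP[vx xs]].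
    exact: top_bag.
  exact: in_top.
- by move=> x y xs ys vx vy; apply/existsP; exists (top v); rewrite !in_top.
- exact: IHs (path_sorted pth).
Qed.

End Tops.

Lemma treewidth2_ltree (H : sgraph) : 1 < #|H| -> treewidth H <= 2 ->
  exists a b t, [/\ uniq (a :: b :: labels t), #|H| = (weight t).+2,
    forall v : H, v \in a :: b :: labels t &
    forall u v : H, adj u v -> joined a b t u v].
Proof.
move=> H_gt1 /treewidthP[D width_D].
have [r _] := root_exists (td_treeP D).
have [par [depth [depth_par adj_par]]] := tree_rooting (td_treeP D) r.
have bag3 (t : td_tree D) : #|td_bag t| <= 3.
  have := leq_bigmax (F := fun t : td_tree D => #|td_bag t|) t.
  by move: width_D; rewrite /td_width; lia.
pose ge_top (u v : H) := depth (top depth_par adj_par v) <= depth (top depth_par adj_par u).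
pose s := sort ge_top (enum H).
have us : uniq s by rewrite sort_uniq enum_uniq.
have sorted_s : sorted ge_top s.
  by apply: sort_sorted => u v; apply: leq_total.
have size_s : size s = #|H| by rewrite size_sort cardE.
have two_s := two_elim_sorted bag3 us sorted_s.
have [|a [b [t [pt jt]]]] := two_elim_ltree (@share_sym _ D) _ two_s.
  by rewrite size_s.
have mem_s v : v \in s by rewrite mem_sort mem_enum.
exists a, b, t; split.
- by rewrite (perm_uniq pt).
- by rewrite -size_s -(perm_size pt) /= size_labels.
- by move=> v; rewrite (perm_mem pt).
- move=> u v uv; apply: jt => //.
    by apply: contraTneq uv => ->; rewrite adj_irrefl.
  by have [t' t'P] := td_edge D uv; apply/existsP; exists t'.
Qed.

(** * The universal graph *)

Lemma wsize_universal_recipe d :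
  (wsize (universal_recipe d)).+1 <= 2 ^ (d * (2 * d + 4)).
Proof.
elim: d => // d IHd; apply: leq_trans (wsize_double_spine _ _) _.
rewrite prednK ?expn_gt0 //.
(* The step adds [3d+6] to the exponent, and the claimed bound allows [4d+6]. *)
apply: leq_trans (_ : 2 ^ 3 * 2 ^ (d.+1 * 3) * 2 ^ (d * (2 * d + 4)) <= _).
  by rewrite -(expnM 2 d.+1 3) leq_mul2l IHd orbT.
by rewrite -!expnD leq_exp2l //; nia.
Qed.

Lemma universal_graph (d n : nat) : 1 < n <= (2 ^ d).+1 ->
  exists U : sgraph, [/\ treewidth U <= 3, #|U| = (wsize (universal_recipe d)).+2 &
    forall H : sgraph, #|H| = n -> treewidth H <= 2 -> contains_subgraph U H].
Proof.
case/andP=> n_gt1 n_le.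
have [N [e [U [i [defN e_sym e01 built_e [i_inj i_onto i_adj cardU twU]]]]]] :=
  recipe_graph (universal_recipe d).
exists U; split=> // [|H cardH twH]; first by rewrite cardU defN.
have [|a [b [t [uniq_t card_t cover_t edge_t]]]] := treewidth2_ltree _ twH.
  by rewrite cardH.
(* The two root vertices carry no weight, which is why [n] may be as large as [2^d + 1]. *)
have le_t : weight t <= (2 ^ d).-1 by move: n_le; rewrite -cardH card_t; lia.
have [u pu /andP[uu /allP u_ran]] := universal_recipeP e_sym built_e le_t.
have u01 : uniq (0 :: 1 :: u).
  rewrite /= inE uu andbT /=; apply/andP; split; apply/negP => /u_ran; lia.
have [f [f_inj f_ran f_hom]] := place_hom e_sym e01 pu u01 uniq_t.
have f_lt v : f v < N.
  have := f_ran v (cover_t v); rewrite defN !inE => /or3P[/eqP->|/eqP->|/u_ran] //.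
  by rewrite add2n => /andP[].
pose g v : U := sval (cid (i_onto _ (f_lt v))).
have ig v : i (g v) = f v by rewrite /g; case: cid.
apply: (contains_subgraph_hom (g := g)) => [x y gxy|x y /edge_t].
  by apply: f_inj; rewrite ?cover_t // -!ig gxy.
rewrite i_adj !ig => /orP[] /f_hom //=.
by rewrite e_sym.
Qed.

Definition one_vertex_graph : sgraph :=
  @SGraph unit (fun _ _ => false) (fun _ _ => erefl) (fun _ => erefl).

Lemma one_vertex_universal : treewidth one_vertex_graph <= 3 /\
  forall H : sgraph, #|H| = 1 -> contains_subgraph one_vertex_graph H.
Proof.
split=> [|H card1].
  apply: (@treewidth_le _ (trivial_td one_vertex_graph)).
  rewrite /td_width -subn1 leq_subLR; apply/bigmax_leqP => t _.
  by apply: leq_trans (max_card _) _; rewrite card_unit.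
have eqH (x y : H) : x = y.
  by have /fintype_le1P := eq_leq card1; apply.
apply: (contains_subgraph_hom (g := fun _ : H => tt : one_vertex_graph)) => [x y _|x y].
  exact: eqH.
by rewrite (eqH x y) adj_irrefl.
Qed.

Local Open Scope ring_scope.

(** With [x] the real binary logarithm of [n], the right side is 2 to the power [20 x^2], and the
    truncated logarithm is at most [x]. *)
Lemma quasipolynomial_le (R : realType) (n : nat) : (0 < n)%N ->
  (2 ^ (20 * trunc_log 2 n ^ 2))%:R <= n%:R `^ (20 * (ln n%:R / ln 2)) :> R.
Proof.
move=> n_gt0; set l := trunc_log 2 n.
have ln2_gt0 : 0 < ln 2 :> R by rewrite ln_gt0 // ltr1n.
have le_l : l%:R * ln 2 <= ln n%:R :> R.
  rewrite mulrC mulr_natr -lnXn // -natrX ler_ln ?posrE ?ltr0n ?expn_gt0 //.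
  by rewrite ler_nat trunc_logP.
have le_x : l%:R <= ln n%:R / ln 2 :> R by rewrite ler_pdivlMr.
have l_ge0 : 0 <= l%:R :> R := ler0n _ _.
rewrite /powR pnatr_eq0 eqn0Ngt n_gt0 -[X in X <= _]lnK ?posrE ?ltr0n ?expn_gt0 //.
rewrite ler_expR natrX lnXn //. rewrite -[ln 2 *+ _]mulr_natr natrM natrX.
have ln_n : ln n%:R = (ln n%:R / ln 2) * ln 2 :> R by rewrite divfK ?gt_eqF.
set x := ln n%:R / ln 2 in le_x ln_n *; rewrite ln_n.
have l_sq : l%:R ^+ 2 <= x ^+ 2 by rewrite ler_sqr ?nnegrE // (le_trans l_ge0).
rewrite [leRHS]mulrA [leRHS]mulrC -[20 * x * x]mulrA -expr2.
by rewrite !ler_pM2l.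
Qed.

Theorem theorem3p12 (R : realType) (n : nat) (n_gt0 : (0 < n)%N) :
  exists U : sgraph,
    [/\ (treewidth U <= 3)%N,
        (#|U|%:R : R) <= n%:R `^ (20 * (ln n%:R / ln 2)) &
        forall H : sgraph, #|H| = n -> (treewidth H <= 2)%N ->
          contains_subgraph U H].
Proof.
(* For [n = 1] the bound is 1, which leaves no room for a root edge. *)
have [->|n_neq1] := eqVneq n 1%N.
  have [tw1 univ1] := one_vertex_universal.
  exists one_vertex_graph; split=> // [|H cardH _]; last exact: univ1.
  by rewrite card_unit powR1.
have n_gt1 : (1 < n)%N by lia.
set l := trunc_log 2 n.
have l_gt0 : (0 < l)%N by rewrite trunc_log_gt0.
have [|U [twU cardU univU]] := @universal_graph l.+1 n.
  by rewrite n_gt1 ltnW // ltnS ltnW // trunc_log_ltn.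
exists U; split=> //; apply: le_trans (quasipolynomial_le R n_gt0).
rewrite ler_nat cardU; set w := wsize _.
have : (w.+1 <= 2 ^ (l.+1 * (2 * l.+1 + 4)))%N by exact: wsize_universal_recipe.
(* With the factor 2 the exponent is [2l^2 + 8l + 7], at most [20 l^2] because [l >= 1]; for [l = 1]
   this reads 17 against 20. *)
move=> le_w; apply: leq_trans (_ : 2 * 2 ^ (l.+1 * (2 * l.+1 + 4)) <= _)%N.
  by lia.
by rewrite -expnS leq_exp2l //; nia.
Qed.
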